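(* Let $0<q<1$ and let $\{\omega_n(z;q)\}_{n\in\mathbb N_0}$ be an even $q$-Lidstone polynomial sequence of type I. Let $\bar\pi_{ij}=\sum_{n=0}^i f_{in}\,g_{(n+1)j}$ $(i,j\in\mathbb N_0)$, with $f_{ij},g_{ij}$ as in the context. Then $\omega_0(z;q)=\frac1{\xi_0}$ and for every $n\in\mathbb N_0$ $$\omega_{n+1}(z;q)= \frac{(-1)^{n+1}\,\omega_0(z;q)}{\bar\pi_{01}\bar\pi_{12} \cdots \bar\pi_{n(n+1)}}\;\det\begin{bmatrix} \bar\pi_{00}-z^2 & \bar\pi_{01} & 0 & \cdots & 0 \\ \bar\pi_{10} & \bar\pi_{11}-z^2 & \bar\pi_{12} & \cdots & 0 \\ \bar\pi_{20} & \bar\pi_{21} & \bar\pi_{22}-z^2 & \ddots & \vdots \\ \vdots & \vdots & \vdots & \ddots & \bar\pi_{(n-1)n}\\ \bar\pi_{n0} & \bar\pi_{n1} & \bar\pi_{n2} & \cdots & \bar\pi_{nn}-z^2 \end{bmatrix},$$ i.e. the determinant is that of the $(n+1)\times(n+1)$ matrix $[\bar\pi_{ij}-z^2\delta_{ij}]_{0\le i,j\le n}$ (where $\bar\pi_{ij}=0$ for $j>i+1$).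
   Context: Fix $0<q<1$. Put $[m]_q=\frac{1-q^m}{1-q}$, $[m]_q!=\prod_{j=1}^m[j]_q$, $[0]_q!=1$, and ${n \brack k}_q=\frac{[n]_q!}{[k]_q!\,[n-k]_q!}$ for $0\le k\le n$. $\mathbb N=\{1,2,\dots\}$, $\mathbb N_0=\mathbb N\cup\{0\}$. The Jackson $q$-derivative is $D_qf(z)=\frac{f(qz)-f(z)}{(q-1)z}$ for $z\ne0$ and $D_qf(0)=f'(0)$, so $D_qz^m=[m]_qz^{m-1}$. An even $q$-Lidstone polynomial sequence of type I (class $q$ELS-I) is a sequence $\{\omega_n(z;q)\}_{n\in\mathbb N_0}$ of polynomials in $z$ with real coefficients such that $D_q^2\omega_n(z;q)=[2n]_q[2n-1]_q\,\omega_{n-1}(z;q)$ for $n\in\mathbb N$, $D_q\omega_n(0;q)=0$ for $n\in\mathbb N_0$, and $\omega_0(z;q)=\gamma_0$ with $\gamma_0\in\mathbb R\setminus\{0\}$. Its associated numerical sequence is $\gamma_{2n}:=\omega_n(0;q)$, and $\omega_n(z;q)=\sum_{k=0}^n{2n \brack 2k}_q\gamma_{2(n-k)}z^{2k}$. The sequence $(\xi_{2n})_{n\ge0}$ is the unique real sequence with $\sum_{j=0}^n\frac{\gamma_{2j}\,\xi_{2(n-j)}}{[2j]_q!\,[2(n-j)]_q!}=\delta_{n0}$ for all $n\in\mathbb N_0$. For $i\ge j$ put $f_{ij}={2i \brack 2j}_q\gamma_{2(i-j)}$ and $g_{ij}={2i \brack 2j}_q\xi_{2(i-j)}$; for $i<j$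 put $f_{ij}=g_{ij}=0$. *)

(* Defs.v *)
From HB Require Import structures.
From mathcomp Require Import all_boot all_order all_algebra.
From mathcomp Require Import all_classical all_reals all_analysis.

Set Implicit Arguments.
Unset Strict Implicit.
Unset Printing Implicit Defensive.

Import Order.TTheory GRing.Theory Num.Theory.
Import numFieldNormedType.Exports.

Local Open Scope ring_scope.

Definition qnum (R : realType) (q : R) (m : nat) : R := (1 - q ^+ m) / (1 - q).

Definition qfact (R : realType) (q : R) (m : nat) : R :=
  \prod_(1 <= j < m.+1) qnum q j.

(* Only meaningful for k <= n: the subtraction is truncated. *)
Definition qbinom (R : realType) (q : R) (n k : nat) : R :=
  qfact q n / (qfact q k * qfact q (n - k)).

Definition qderiv (R : realType) (q : R) (f : R -> R) (z : R) : R :=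
  if z == 0 then derive1 f 0 else (f (q * z) - f z) / ((q - 1) * z).

Definition is_qELS1 (R : realType) (q : R) (w : nat -> {poly R}) : Prop :=
  [/\ forall n, (0 < n)%N -> forall z : R,
        qderiv q (qderiv q (horner (w n))) z
        = qnum q (2 * n) * qnum q (2 * n - 1) * (w n.-1).[z],
      forall n, qderiv q (horner (w n)) 0 = 0
    & exists2 gamma0 : R, gamma0 != 0 & w 0%N = gamma0%:P].

(* The sequences gamma_{2n} and xi_{2n} only have even indices; here they are
   functions of n, so that gamma n stands for gamma_{2n}, and likewise for xi. *)
Definition numseq (R : realType) (w : nat -> {poly R}) (n : nat) : R :=
  (w n).[0].

(* For gamma 0 != 0 these equations have exactly one solution xi. *)
Definition is_conj_seq (R : realType) (q : R) (gamma xi : nat -> R) : Prop :=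
  forall n : nat,
    \sum_(0 <= j < n.+1)
       (gamma j * xi (n - j)%N) / (qfact q (2 * j) * qfact q (2 * (n - j)))
    = (n == 0%N)%:R.

(* The entries f_ij (for a = gamma) and g_ij (for a = xi). *)
Definition lidstone_mx (R : realType) (q : R) (a : nat -> R) (i j : nat) : R :=
  if (j <= i)%N then qbinom q (2 * i) (2 * j) * a (i - j)%N else 0.

Definition pibar (R : realType) (q : R) (gamma xi : nat -> R) (i j : nat) : R :=
  \sum_(0 <= n < i.+1) lidstone_mx q gamma i n * lidstone_mx q xi n.+1 j.

(* Main.v *)
(* The numbers f_ij are the coefficients of w in the basis z^(2j), and since
   the q-exponential generating series of gamma and xi are mutually inverse,
   the lower triangular matrices F and G are inverse to each other. Hence
   pibar = F S G, with S the shift, is the matrix of multiplication by z^2 in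
   the basis w:
     z^2 w_i = sum over j <= i + 1 of pibar_ij w_j.
   The first n + 1 of these relations form a Hessenberg linear system with
   unknowns w_0, ..., w_n and right-hand side - pibar_(n,n+1) w_(n+1) e_n;
   Cramer's rule for w_0 involves only the corner cofactor, which is triangular,
   and solving for w_(n+1) gives the formula. *)
Require Import Defs.
From mathcomp Require Import all_boot all_order all_algebra.
From mathcomp Require Import all_classical all_reals all_analysis.
From mathcomp Require Import ring zify.

Set Implicit Arguments.
Unset Strict Implicit.
Unset Printing Implicit Defensive.

Import Order.TTheory GRing.Theory Num.Theory.
Local Open Scope ring_scope.

(** * Polynomial identity and Hessenberg determinants *)

Lemma horner_ext_inj (R : numDomainType) (p r : {poly R}) :
  (forall x, p.[x] = r.[x]) -> p = r.
Proof.
move=> pr; apply/eqP; rewrite -subr_eq0; apply/eqP.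
(* In characteristic zero these are [size (p - r)] distinct points, too many roots for a nonzero
   [p - r]. *)
pose s := [seq (i%:R : R) | i <- iota 0 (size (p - r))].
apply: (@roots_geq_poly_eq0 _ _ s); last by rewrite size_map size_iota.
- by apply/allP => x _; rewrite rootE hornerD hornerN pr subrr.
- rewrite map_inj_uniq ?iota_uniq // => i j /eqP.
  by rewrite eqr_nat => /eqP.
Qed.

(** Cramer's rule via [\adj M *m M], hence free of division: it will be applied to polynomial
    entries. *)
Lemma det_hessenberg (R : comUnitRingType) (b : nat -> nat -> R) (v : nat -> R)
    (n : nat) :
  (forall i j, (i.+1 < j)%N -> b i j = 0) ->
  (forall i, (i <= n)%N -> \sum_(j < i.+2) b i j * v j = 0) ->
  \det (\matrix_(i < n.+1, j < n.+1) b i j) * v 0%N =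
    (-1) ^+ n.+1 * (\prod_(k < n.+1) b k k.+1) * v n.+1.
Proof.
move=> b0 bv.
set M := \matrix_(i < n.+1, j < n.+1) b i j.
pose V : 'cV[R]_n.+1 := \col_(j < n.+1) v j.
have MV (i : 'I_n.+1) :
    (M *m V) i 0 = - ((i == ord_max)%:R * (b n n.+1 * v n.+1)).
  have -> : (M *m V) i 0 = \sum_(j < n.+1) b i j * v j.
    by rewrite mxE; apply: eq_bigr => j _; rewrite !mxE.
  have := bv i (ltn_ord i).
  case: (eqVneq i ord_max) => [->|ni] /=.
    (* The last equation has one term more than [M] has columns; it becomes the right-hand side. *)
    by rewrite big_ord_recr /= mul1r => /eqP; rewrite addr_eq0 => /eqP.
  have ltin : (i < n)%N.
    by rewrite ltn_neqAle -ltnS ltn_ord andbT; apply: contraNneq ni => e;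
       apply/eqP/val_inj.
  (* Above the last row, all [i + 2] terms fit inside [M], and the remaining entries of the row
     vanish. *)
  rewrite mul0r oppr0 (@big_ord_widen _ _ _ i.+2 n.+1 (fun j => b i j * v j)) //.
  rewrite big_mkcond => S0; rewrite -[RHS]S0; apply: eq_bigr => j _.
  by case: ltnP => // /b0 ->; rewrite mul0r.
(* Deleting the last row and the first column moves the superdiagonal onto the diagonal of a lower
   triangular matrix. *)
have cof : cofactor M ord_max 0 = (-1) ^+ n * \prod_(k < n) b k k.+1.
  rewrite /cofactor addn0 det_trig.
    congr (_ * _); apply: eq_bigr => k _; rewrite !mxE.
    by rewrite lift_max lift0.
  apply/is_trig_mxP => i j ij; rewrite !mxE lift_max lift0.
  by rewrite b0.
have : (\adj M *m M *m V) 0 0 = \det M * v 0%N.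
  by rewrite mul_adj_mx mul_scalar_mx !mxE.
move=> <-; rewrite -mulmxA mxE (bigD1 ord_max) //= big1 => [|i ni].
  rewrite MV eqxx mul1r addr0 mxE cof big_ord_recr /= exprS; ring.
by rewrite MV (negbTE ni) mul0r oppr0 mulr0.
Qed.

(** * The Jackson derivative on coefficients *)

Definition qderiv_poly (R : realType) (q : R) (p : {poly R}) : {poly R} :=
  \poly_(i < size p) (qnum q i.+1 * p`_i.+1).

Lemma coef_qderiv_poly (R : realType) (q : R) (p : {poly R}) i :
  (qderiv_poly q p)`_i = qnum q i.+1 * p`_i.+1.
Proof.
rewrite coef_poly; case: ltnP => // si.
by rewrite nth_default ?mulr0 // (leq_trans si).
Qed.

Section QCalculus.
Variables (R : realType) (q : R).
Hypotheses (q_gt0 : 0 < q) (q_lt1 : q < 1).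

Lemma qnum_gt0 m : (0 < m)%N -> 0 < qnum q m.
Proof.
move=> m0; rewrite /qnum divr_gt0 ?subr_gt0 //.
by rewrite exprn_ilt1 ?ltW // -lt0n.
Qed.

Lemma qnum1 : qnum q 1 = 1.
Proof. by rewrite /qnum expr1 divff // subr_eq0 gt_eqF. Qed.

Lemma qfactS m : qfact q m.+1 = qnum q m.+1 * qfact q m.
Proof. by rewrite /qfact big_nat_recr //= mulrC. Qed.

Lemma qfact_neq0 m : qfact q m != 0.
Proof.
elim: m => [|m IH]; first by rewrite /qfact big_geq ?oner_neq0.
by rewrite qfactS mulf_neq0 // gt_eqF // qnum_gt0.
Qed.

Lemma qbinomn0 n : qbinom q n 0 = 1.
Proof.
rewrite /qbinom subn0 {2}/qfact big_geq // mul1r divff //; exact: qfact_neq0.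
Qed.

Lemma qbinomnn n : qbinom q n n = 1.
Proof.
rewrite /qbinom subnn {3}/qfact big_geq // mulr1 divff //; exact: qfact_neq0.
Qed.

Lemma qderiv_horner (p : {poly R}) :
  qderiv q (horner p) = horner (qderiv_poly q p).
Proof.
apply/funext => z; rewrite /qderiv; case: eqP => [->|/eqP z0].
  rewrite -derivE !horner_coef0 coef_deriv coef_qderiv_poly qnum1 mul1r.
  by rewrite mulr1n.
have q1 : q - 1 != 0 by rewrite subr_eq0 lt_eqF.
apply: (mulIf (mulf_neq0 q1 z0)); rewrite divfK ?mulf_neq0 //.
(* One zero coefficient is added to [p], so that [size p] terms remain once the constant terms
   cancel. *)
rewrite !(@horner_coef_wide _ (size p).+1 p) // horner_poly -sumrB.
rewrite big_ord_recl /= !expr0 subrr add0r mulr_suml; apply: eq_bigr => i _.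
rewrite /bump leq0n add1n /qnum exprMn [z ^+ i.+1]exprSr.
have q1' : 1 - q != 0 by rewrite -opprB oppr_eq0.
by field.
Qed.

(** * The triangular matrices F and G, and [pibar] *)

Lemma lidstone_mx_diag (a : nat -> R) i : lidstone_mx q a i i = a 0%N.
Proof. by rewrite /lidstone_mx leqnn subnn qbinomnn mul1r. Qed.

Lemma lidstone_mx_gt (a : nat -> R) i j :
  (i < j)%N -> lidstone_mx q a i j = 0.
Proof. by rewrite /lidstone_mx ltnNge => /negbTE ->. Qed.

(** For [j <= i], shifting [k] by [j] turns the sum into [qfact q (2 * i) / qfact q (2 * j)] times
    the defining equation of the conjugate sequence at [i - j]. *)
Lemma lidstone_mx_inv (a b : nat -> R) i j : is_conj_seq q a b ->
  \sum_(0 <= k < i.+1) lidstone_mx q b i k * lidstone_mx q a k j = (i == j)%:R.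
Proof.
move=> ab; case: (ltnP i j) => [ij|ji].
  rewrite ltn_eqF // big_nat big1 // => k /andP[_ ki].
  by rewrite (@lidstone_mx_gt a) ?mulr0 // (leq_ltn_trans _ ij).
rewrite (big_cat_nat (m:=0) (n:=j)) ?(leq_trans ji) //= [X in X + _]big_nat.
rewrite big1 => [|k /andP[_ kj]]; last by rewrite (@lidstone_mx_gt a) ?mulr0.
rewrite add0r -{1}[j]add0n big_addn.
have -> : (i == j)%:R = (i - j == 0)%N%:R * (qfact q (2 * i) / qfact q (2 * j)).
  rewrite subn_eq0; case: eqP => [->|/eqP nij].
    by rewrite leqnn divff ?mulr1 ?qfact_neq0.
  by rewrite leqNgt ltn_neqAle eq_sym nij ji mul0r.
rewrite -(ab (i - j)%N) subSn // mulr_suml.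
rewrite !big_nat; apply: eq_bigr => k /andP[_ ki].
have kji : (k + j <= i)%N by lia.
rewrite /lidstone_mx kji leq_addl addnK /qbinom.
have -> : (2 * i - 2 * (k + j) = 2 * (i - j - k))%N by lia.
have -> : (2 * (k + j) - 2 * j = 2 * k)%N by lia.
have -> : (i - (k + j) = i - j - k)%N by lia.
by field; rewrite !qfact_neq0.
Qed.

Lemma pibar_gt (a b : nat -> R) i j : (i.+1 < j)%N -> pibar q a b i j = 0.
Proof.
move=> ij; rewrite /pibar big_nat big1 // => k /andP[_ ki].
by rewrite (@lidstone_mx_gt b) ?mulr0 // (leq_ltn_trans _ ij).
Qed.

Lemma pibar_superdiag (a b : nat -> R) i :
  pibar q a b i i.+1 = a 0%N * b 0%N.
Proof.
rewrite /pibar big_nat_recr //= !lidstone_mx_diag big_nat big1 ?add0r //.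
by move=> k /andP[_ ki]; rewrite (@lidstone_mx_gt b) ?mulr0.
Qed.

Lemma conj_seq0 (a b : nat -> R) : is_conj_seq q a b -> a 0%N * b 0%N = 1.
Proof.
move=> /(_ 0%N); rewrite big_nat1 subnn /= /qfact big_geq // mul1r.
by rewrite divr1.
Qed.

(** * Expansions between the polynomials and the even powers *)

Lemma qELS1_expansion (w : nat -> {poly R}) n : is_qELS1 q w ->
  w n = \sum_(0 <= k < n.+1) lidstone_mx q (numseq w) n k *: 'X^(2 * k).
Proof.
case=> w2 w1 [c c0 w0].
(* Comparing coefficients in the second-order equation lowers [m] by one and the degree by two;
   degrees 0 and 1 are the initial data. *)
have rec m i : qnum q i.+1 * (qnum q i.+2 * (w m.+1)`_i.+2) =
    qnum q (2 * m.+1) * qnum q (2 * m.+1 - 1) * (w m)`_i.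
  rewrite -!coef_qderiv_poly -coefZ.
  suff -> : qderiv_poly q (qderiv_poly q (w m.+1)) =
      (qnum q (2 * m.+1) * qnum q (2 * m.+1 - 1)) *: w m by [].
  by apply: horner_ext_inj => x; rewrite -!qderiv_horner w2 // hornerZ.
have odd1 m : (w m)`_1 = 0.
  have := w1 m; rewrite qderiv_horner horner_coef0 coef_qderiv_poly.
  by rewrite qnum1 mul1r.
have coefE m i : (w m)`_i =
    if odd i then 0 else lidstone_mx q (numseq w) m i./2.
  elim: m i => [|m IH] [|[|i]] //.
  - by rewrite /= /lidstone_mx muln0 qbinomn0 mul1r subn0 /numseq horner_coef0.
  - by rewrite w0 coefC /= (@lidstone_mx_gt (numseq w)) //; case: ifP.
  - by rewrite /= /lidstone_mx muln0 qbinomn0 mul1r subn0 /numseq horner_coef0.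
  have qn0 k : qnum q k.+1 != 0 by rewrite gt_eqF // qnum_gt0.
  apply: (mulfI (qn0 i.+1)); apply: (mulfI (qn0 i)); rewrite rec IH /= negbK.
  case: ifP => [_|/negbT ei]; first by rewrite !mulr0.
  rewrite /lidstone_mx ltnS subSS; case: leqP => im; last by rewrite !mulr0.
  have {ei}[k ik] : exists k, i = (2 * k)%N by exists i./2; lia.
  have -> : i./2 = k by lia.
  rewrite ik /qbinom.
  have -> : (2 * m.+1 - 1 = (2 * m).+1)%N by lia.
  have -> : (2 * m.+1 - 2 * k.+1 = 2 * m - 2 * k)%N by lia.
  have -> : (2 * m.+1 = (2 * m).+2)%N by lia.
  have -> : (2 * k.+1 = (2 * k).+2)%N by lia.
  rewrite !qfactS.
  by field; rewrite !qn0 !qfact_neq0.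
apply/polyP => i; rewrite coefE coef_sum.
under eq_bigr do rewrite coefZ coefXn.
case: ifP => [oi|/negbT ei].
  by rewrite big1 // => k _; case: eqP => [e|]; [lia | rewrite mulr0].
have e k : (i == (2 * k)%N) = (k == i./2) by lia.
under eq_bigr do rewrite e.
case: (ltnP n i./2) => ni.
  rewrite lidstone_mx_gt // big_nat big1 // => k /andP[_ kn].
  by rewrite ltn_eqF ?mulr0 // (leq_trans kn).
rewrite (bigD1_seq i./2) ?iota_uniq ?mem_index_iota //= eqxx mulr1 big1 ?addr0 //.
by move=> k /negbTE ->; rewrite mulr0.
Qed.

(** G undoes F. The free bound [N] lets one summation range serve all [n <= N], as the exchange of
    sums in [qELS1_recurrence] requires. *)
Lemma qELS1_inverse_expansion (w : nat -> {poly R}) (xi : nat -> R) n N :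
  is_qELS1 q w -> is_conj_seq q (numseq w) xi -> (n <= N)%N ->
  \sum_(0 <= j < N.+1) lidstone_mx q xi n j *: w j = 'X^(2 * n).
Proof.
move=> hw hx nN.
rewrite (big_cat_nat (m:=0) (n:=n.+1)) //= [X in _ + X]big_nat.
rewrite [X in _ + X]big1 => [|j /andP[nj _]]; last first.
  by rewrite lidstone_mx_gt ?scale0r.
(* Zero terms give all expansions the same range, so that the sums can be exchanged. *)
have wE j : (j < n.+1)%N -> w j =
    \sum_(0 <= k < n.+1) lidstone_mx q (numseq w) j k *: 'X^(2 * k).
  move=> jn; rewrite {1}(qELS1_expansion j hw).
  rewrite [RHS](big_cat_nat (m:=0) (n:=j.+1)) //= [X in _ + X]big_nat.
  rewrite [X in _ + X]big1 ?addr0 // => k /andP[jk _].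
  by rewrite lidstone_mx_gt ?scale0r.
rewrite addr0 big_nat.
under eq_bigr => j /andP[_ jn] do rewrite (wE j jn) scaler_sumr.
rewrite -big_nat exchange_big_nat //=.
under eq_bigr => k _.
  under eq_bigr do rewrite scalerA.
  rewrite -scaler_suml lidstone_mx_inv //.
  over.
rewrite big_nat_recr //= eqxx scale1r big_nat big1 ?add0r //.
by move=> k /andP[_ kn]; rewrite gtn_eqF ?scale0r.
Qed.

(** Summing over [j] first collapses G to the powers ['X^(2 * k.+1)]; pulling out ['X^2] leaves the
    expansion of [w i]. *)
Lemma qELS1_recurrence (w : nat -> {poly R}) (xi : nat -> R) i :
  is_qELS1 q w -> is_conj_seq q (numseq w) xi ->
  \sum_(0 <= j < i.+2) pibar q (numseq w) xi i j *: w j = 'X^2 * w i.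
Proof.
move=> hw hx; under eq_bigr do rewrite /pibar scaler_suml.
rewrite exchange_big_nat //= [in RHS](qELS1_expansion i hw) mulr_sumr.
rewrite !big_nat; apply: eq_bigr => k /andP[_ ki].
under eq_bigr do rewrite -scalerA.
rewrite -scaler_sumr (@qELS1_inverse_expansion w xi k.+1 i.+1) //.
by rewrite -scalerAr -exprD mulnS.
Qed.

End QCalculus.

Theorem theorem3p16 (R : realType) (q : R) (w : nat -> {poly R})
    (xi : nat -> R) (q_gt0 : 0 < q) (q_lt1 : q < 1) (w_qELS1 : is_qELS1 q w)
    (xi_conj : is_conj_seq q (numseq w) xi) :
  w 0%N = (1 / xi 0%N)%:P /\
  forall n : nat,
    w n.+1 =
      ((-1) ^+ n.+1 / \prod_(k < n.+1) pibar q (numseq w) xi k k.+1)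
      *: (w 0%N *
          \det (\matrix_(i < n.+1, j < n.+1)
                  ((pibar q (numseq w) xi i j)%:P
                   - (if i == j then 'X^2 else 0)))).
Proof.
have gx := conj_seq0 xi_conj.
have x0 : xi 0%N != 0.
  by apply: contra_eq_neq gx => ->; rewrite mulr0 eq_sym oner_neq0.
split.
  have [_ _ [c c0 wc]] := w_qELS1.
  by rewrite -gx mulfK // /numseq wc hornerC.
move=> n.
pose b i j : {poly R} :=
  (pibar q (numseq w) xi i j)%:P - (if i == j then 'X^2 else 0).
(* The superdiagonal entries are all [gamma_0 * xi_0 = 1], so both products are 1. *)
have b1 k : b k k.+1 = 1.
  by rewrite /b ltn_eqF // subr0 pibar_superdiag // gx.
have := @det_hessenberg _ b w n.
rewrite big1 // mulr1 => H.
rewrite big1 => [|k _]; last by rewrite pibar_superdiag.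
rewrite divr1 [w 0%N * _]mulrC H; last first.
- move=> i _; rewrite /b.
  under eq_bigr do rewrite mulrBl mul_polyC.
  (* The first sum is ['X^2 * w i] by the recurrence; the second has only its term [j = i], which is
     the same. *)
  rewrite sumrB -(big_mkord xpredT (fun j => pibar q (numseq w) xi i j *: w j)).
  rewrite qELS1_recurrence // (bigD1 (Ordinal (leqnSn i.+1))) //= eqxx.
  rewrite big1 ?addr0 ?subrr // => j ji; case: eqP => [e|]; rewrite ?mul0r //.
  by case/eqP: ji; apply: val_inj.
- by move=> i j ij; rewrite /b pibar_gt // ltn_eqF ?subr0 // ltnW.
- rewrite -!(signr_odd _ n.+1) scaler_sign mulr_sign.
  by case: odd; rewrite ?opprK.
Qed.
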